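(* Let $s_1,s_2$ be nonnegative integers, not both zero, with $(s_1,s_2)\notin\{(1,0),(0,1),(1,1)\}$, let $D$ be the set of positive divisors of $\gcd(s_1,s_2)$, and let $G$ be the rotational group of the toroidal hypermap $(3,3,3)_{(s_1,s_2)}$. The set of all possible degrees of a faithful transitive permutation representation of $G$ is $$\Big\{s_1^2+s_1s_2+s_2^2\Big\}\cup\Big\{\tfrac{3(s_1^2+s_1s_2+s_2^2)}{d}\ \Big|\ d\in D\Big\}.$$
   Context: The rotational group (orientation-preserving automorphism group) of the toroidal hypermap $(3,3,3)_{(s_1,s_2)}$ is the group $$G=\langle a,b\mid a^3=b^3=(ab)^3=1,\ u^{s_1}v^{s_2}=1\rangle,\qquad u:=ab^{-1},\ v:=a^{-1}b,$$ where $a$ is a rotation around a hyperface, $b$ a rotation around a hypervertex, and $u,v$ are unit translations. A faithful transitive permutation representation of $G$ of degree $n$ is a faithful transitive action of $G$ on a set of size $n$; equivalently, $n$ is the index in $G$ of a core-free subgroup (a subgroup $H$ with $\bigcap_{g\in G}g^{-1}Hg=1$). Convention: $\gcd(s,0)=\gcd(0,s)=s$. *)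

(* Defs.v *)
From HB Require Import structures.
From mathcomp Require Import all_boot all_fingroup.
From mathcomp Require Import boolp generic_quotient.

Set Implicit Arguments.
Unset Strict Implicit.
Unset Printing Implicit Defensive.

Local Open Scope group_scope.
Local Open Scope quotient_scope.

(* MathComp's [G \isog Grp (...)] only sees the largest finite quotient of a
   presented group, so the group presented by generators and relators is
   constructed here, as words modulo the congruence generated by the relators. *)

(* The letter (x, false) stands for x and (x, true) for its formal inverse. *)
Definition word (X : Type) := seq (X * bool).

Definition wgen (X : Type) (x : X) : word X := [:: (x, false)].
Definition winv (X : Type) (w : word X) : word X :=
  rev [seq (l.1, ~~ l.2) | l <- w].
Definition wexp (X : Type) (w : word X) (n : nat) : word X := iter n (cat w) [::].

Section Presentation.
Variables (X : choiceType) (R : seq (word X)).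

Inductive wcongr : word X -> word X -> Prop :=
| wcongr_refl w : wcongr w w
| wcongr_sym w1 w2 : wcongr w1 w2 -> wcongr w2 w1
| wcongr_trans w1 w2 w3 : wcongr w1 w2 -> wcongr w2 w3 -> wcongr w1 w3
| wcongr_cat w1 w1' w2 w2' :
    wcongr w1 w1' -> wcongr w2 w2' -> wcongr (w1 ++ w2) (w1' ++ w2')
| wcongr_cancel x e : wcongr [:: (x, e); (x, ~~ e)] [::]
| wcongr_relator r : r \in R -> wcongr r [::].

Definition wcongrb (w1 w2 : word X) : bool := `[< wcongr w1 w2 >].

Lemma wcongrb_equiv : equiv_class_of wcongrb.
Proof.
split=> [w|w1 w2|w2 w1 w3].
- exact/asboolP/wcongr_refl.
- by apply/asboolP/asboolP => /wcongr_sym.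
- by move=> /asboolP h12 /asboolP h23; apply/asboolP; apply: wcongr_trans h23.
Qed.

Canonical wcongr_equiv := EquivRelPack wcongrb_equiv.

Definition presented := {eq_quot wcongr_equiv}.
HB.instance Definition _ := Choice.on presented.
HB.instance Definition _ := EqQuotient.on presented.

Lemma presented_eqP (w1 w2 : word X) :
  \pi_presented w1 = \pi_presented w2 <-> wcongr w1 w2.
Proof. by split=> [/eqmodP/asboolP|?] //; apply/eqmodP/asboolP. Qed.

Lemma presentedP (g : presented) : exists w : word X, g = \pi_presented w.
Proof. by exists (repr g); rewrite reprK. Qed.

Lemma wcongr_repr (w : word X) : wcongr (repr (\pi_presented w)) w.
Proof. by apply/presented_eqP; rewrite reprK. Qed.

Lemma winv_cat (w1 w2 : word X) : winv (w1 ++ w2) = winv w2 ++ winv w1.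
Proof. by rewrite /winv map_cat rev_cat. Qed.

Lemma winvK : involutive (@winv X).
Proof.
move=> w; rewrite /winv map_rev revK -map_comp -[RHS]map_id.
by apply: eq_map => -[x e] /=; rewrite negbK.
Qed.

Lemma wcongr_mulV (w : word X) : wcongr (w ++ winv w) [::].
Proof.
elim: w => [|[x e] w IHw]; first exact: wcongr_refl.
rewrite -cat1s winv_cat -catA [w ++ _]catA.
apply: wcongr_trans (wcongr_cancel x e).
rewrite -[X in wcongr _ X]/([:: (x, e)] ++ ([::] ++ winv [:: (x, e)])).
apply: wcongr_cat; first exact: wcongr_refl.
by apply: wcongr_cat; [exact: IHw | exact: wcongr_refl].
Qed.

Lemma wcongr_winv (w1 w2 : word X) : wcongr w1 w2 -> wcongr (winv w1) (winv w2).
Proof.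
move=> h; apply: (@wcongr_trans _ (winv w1 ++ (w2 ++ winv w2))).
  rewrite -[X in wcongr X _]cats0; apply: wcongr_cat; first exact: wcongr_refl.
  exact/wcongr_sym/wcongr_mulV.
rewrite catA -[X in wcongr _ X]cat0s; apply: wcongr_cat; last exact: wcongr_refl.
apply: (@wcongr_trans _ (winv w1 ++ w1)).
  by apply: wcongr_cat; [exact: wcongr_refl | exact: wcongr_sym].
by rewrite -{2}[w1]winvK; exact: wcongr_mulV.
Qed.

Definition pone : presented := \pi_presented [::].
Definition pmul (g h : presented) : presented :=
  \pi_presented (repr g ++ repr h).
Definition pinv (g : presented) : presented := \pi_presented (winv (repr g)).

Lemma pmul_pi (w1 w2 : word X) :
  pmul (\pi_presented w1) (\pi_presented w2) = \pi_presented (w1 ++ w2).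
Proof. by apply/presented_eqP/wcongr_cat; exact: wcongr_repr. Qed.

Lemma pinv_pi (w : word X) : pinv (\pi_presented w) = \pi_presented (winv w).
Proof. exact/presented_eqP/wcongr_winv/wcongr_repr. Qed.

Lemma pmulA : associative pmul.
Proof.
move=> g h k; have [w1 ->] := presentedP g.
have [w2 ->] := presentedP h; have [w3 ->] := presentedP k.
by rewrite !pmul_pi catA.
Qed.

Lemma pmul1g : left_id pone pmul.
Proof. by move=> g; have [w ->] := presentedP g; rewrite pmul_pi. Qed.

Lemma pmulg1 : right_id pone pmul.
Proof. by move=> g; have [w ->] := presentedP g; rewrite pmul_pi cats0. Qed.

Lemma pmulVg : left_inverse pone pinv pmul.
Proof.
move=> g; have [w ->] := presentedP g.
rewrite pinv_pi pmul_pi; apply/presented_eqP.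
by rewrite -[X in _ ++ X]winvK; exact: wcongr_mulV.
Qed.

Lemma pmulgV : right_inverse pone pinv pmul.
Proof.
move=> g; have [w ->] := presentedP g.
by rewrite pinv_pi pmul_pi; exact/presented_eqP/wcongr_mulV.
Qed.

HB.instance Definition _ :=
  isGroup.Build presented pmulA pmul1g pmulg1 pmulVg pmulgV.

End Presentation.

(* The generating set {a, b} is encoded as bool. *)
Definition hypermap333_relators (s1 s2 : nat) : seq (word bool) :=
  let a := wgen true in
  let b := wgen false in
  let u := a ++ winv b in
  let v := winv a ++ b in
  [:: wexp a 3; wexp b 3; wexp (a ++ b) 3; wexp u s1 ++ wexp v s2].

Definition hypermap333_group (s1 s2 : nat) : groupType :=
  presented (hypermap333_relators s1 s2).

(* Permutations of MathComp compose from left to right, so a morphism into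
   {perm T} is a right action on T. *)
Definition faithful_transitive_degree (G : groupType) (n : nat) : Prop :=
  exists (T : finType) (f : {multiplicative G -> {perm T}}),
    [/\ #|T| = n, (0 < n)%N, injective f
      & forall x y : T, exists g : G, f g x = y].

(* Main.v *)
Require Import Defs.
From HB Require Import structures.
From mathcomp Require Import all_boot all_order all_fingroup all_algebra.
From mathcomp Require Import cyclic.
From mathcomp Require Import boolp generic_quotient zify ring.

Set Implicit Arguments.
Unset Strict Implicit.
Unset Printing Implicit Defensive.

Import Order.TTheory GRing.Theory Num.Theory.

(** The translations form a group isomorphic to the additive group of the
    Eisenstein integers modulo one of them, and every step below is a piece of
    arithmetic there.  Let w be a primitive cube root of unity.  Conjugation by
    a sends u to v^-1 and v to u v^-1, so writing u^i v^j as i - j w turns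
    conjugation by a into multiplication by w.  The last relator and its
    conjugates kill exactly the multiples of alpha = s1 - s2 w, whose norm is
    N = s1^2 + s1 s2 + s2^2.  Hence G is the semidirect product of
    T = Z[w]/(alpha), of order N, and the group of order 3 generated by a, and
    #|G| = 3 N.

    That no further collapse occurs ([embedding_ker]) is read off an explicit
    finite model: in the affine group of Z[w]/(N), let a act as multiplication
    by w and u as translation by the conjugate of alpha, which is N/alpha.  A
    translation gamma then acts trivially iff N divides gamma N/alpha, that is,
    iff alpha divides gamma.

    Degrees of faithful transitive actions are indices of core-free subgroups
    H ([core_free_degree], [degree_core_free]).  Write g = gcd(s1, s2) and
    alpha = g beta.

    If H is not contained in T, then H meets T in a subgroup normalised by H
    and, T being abelian, by T, hence normal in G and so trivial.  Thus
    #|H| = 3, and the index is N ([core_free_nsub_T]).  Conversely the subgroup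
    generated by a is core-free as soon as a does not centralise T, which fails
    only when N divides 3; these are the excluded pairs ([core_free_cycle_a],
    [in_lattice_1_2]).

    If H is contained in T, then g kills H: the subgroup of g-th powers of T,
    isomorphic to Z[w]/(beta), is cyclic because the coordinates of beta are
    coprime, so each of its subgroups is normal in G.  Since 1 + w + w^2 = 0,
    the intersection of H and H^a is stable under a, hence trivial.  So H and
    H^a span a subgroup of order #|H|^2 inside the g-torsion of T, which is
    generated by beta and w beta and so has order dividing g^2.  Therefore #|H|
    divides g ([core_free_sub_T]).  Conversely beta has order g, and the
    subgroup of order d of the cyclic group that it generates is core-free for
    every divisor d of g, beta and w beta being independent
    ([core_free_beta]). *)

(** * Integer powers in a group *)
Section IntegerPowers.
Local Open Scope group_scope.
Variable G : groupType.
Implicit Types (x y : G) (i j : int).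

Definition zexpg x i : G :=
  match i with Posz n => x ^+ n | Negz n => x ^- n.+1 end.

Lemma zexpg_succ x i : zexpg x (i + 1)%R = zexpg x i * x.
Proof.
case: i => [n|n]; first by rewrite -PoszD addn1 /= expgSr.
rewrite NegzE addrC subzSS sub0r /= expgS invgM -mulgA mulVg mulg1.
by case: n => [|n] //=; rewrite expg0 invg1.
Qed.

Lemma zexpg_pred x i : zexpg x (i - 1)%R = zexpg x i * x^-1.
Proof. by rewrite -{2}(subrK 1%R i) zexpg_succ mulgK. Qed.

Lemma zexpgD x i j : zexpg x (i + j)%R = zexpg x i * zexpg x j.
Proof.
elim/int_ind: j => [|n IHn|n IHn]; first by rewrite addr0 mulg1.
  by rewrite -addn1 PoszD addrA zexpg_succ IHn -mulgA -zexpg_succ.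
by rewrite -addn1 PoszD opprD addrA zexpg_pred IHn -mulgA -zexpg_pred.
Qed.

Lemma zexpgN x i : zexpg x (- i)%R = (zexpg x i)^-1.
Proof. by apply/esym/mulg1_eq; rewrite -zexpgD subrr. Qed.

Lemma zexpgM x i j : zexpg x (i * j)%R = zexpg (zexpg x i) j.
Proof.
elim/int_ind: j => [|n IHn|n IHn]; first by rewrite mulr0.
  by rewrite -addn1 PoszD mulrDr mulr1 !zexpgD IHn.
by rewrite -addn1 PoszD opprD mulrBr mulr1 !zexpgD IHn !zexpgN.
Qed.

Lemma zexpgJ x y i : zexpg x i ^ y = zexpg (x ^ y) i.
Proof. by case: i => n /=; rewrite ?conjVg conjXg. Qed.

Lemma zexpVg x i : zexpg x^-1 i = (zexpg x i)^-1.
Proof. by case: i => n /=; rewrite expVgn. Qed.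

Lemma zexp1g i : zexpg 1 i = 1.
Proof. by case: i => n /=; rewrite expg1n ?invg1. Qed.

Lemma commute_zexpg x y i j :
  commute x y -> commute (zexpg x i) (zexpg y j).
Proof.
move=> cxy; have cx n m := commuteX2 n m cxy.
case: i j => m [] n /=; first exact: cx.
- exact: commuteV.
- by apply/commute_sym/commuteV/commute_sym.
- by apply/commuteV/commute_sym/commuteV/commute_sym.
Qed.

Lemma zexpgMl x y i : commute x y -> zexpg (x * y) i = zexpg x i * zexpg y i.
Proof.
move=> cxy; case: i => n /=; first exact: expgMn.
by rewrite expgMn // invgM; apply/(commute_zexpg (Negz n) (Negz n))/commute_sym.
Qed.

End IntegerPowers.

(** * Translations in a quotient of the triangle group (3,3,3) *)
Section Translations.
Local Open Scope group_scope.
Variables (G : groupType) (a b : G).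
Hypotheses (a3 : a ^+ 3 = 1) (b3 : b ^+ 3 = 1) (ab3 : (a * b) ^+ 3 = 1).

(** The translation i - j w.  It is locked so that associativity rewriting
    treats it as a single factor. *)
Definition transl i j :=
  locked (zexpg (a * b^-1) i * zexpg (a^-1 * b) j).
Local Notation tr := transl.

Lemma translE i j : tr i j = zexpg (a * b^-1) i * zexpg (a^-1 * b) j.
Proof. by rewrite /transl -lock. Qed.

(** The relation (ab)^3 = 1 in the form that exchanges a and b; with
    a^3 = b^3 = 1 it is what makes u and v commute. *)
Lemma mul_aba : a * b * a = b^-1 * a^-1 * b^-1.
Proof.
move/eqP: ab3; rewrite (expgnDr _ 2 1) mulg_eq1 invgM => /eqP e.
by rewrite -e !expgS expg0 !mulg1 !mulgA mulgK.
Qed.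

Lemma sqrg_a : a * a = a^-1.
Proof. by exact/esym/mulg1_eq. Qed.

Lemma unit_translJl : (a * b^-1) ^ a = (a^-1 * b)^-1.
Proof. by rewrite conjgE invgM invgK !mulgA mulVg mul1g. Qed.

Lemma unit_translJr : (a^-1 * b) ^ a = (a * b^-1) * (a^-1 * b)^-1.
Proof.
have bVbV : b^-1 * b^-1 = b.
  by rewrite -invgM; apply: mulg1_eq; rewrite -mulgA.
by rewrite conjgE invgM invgK !mulgA -(mulgA a) bVbV -invgM sqrg_a invgK.
Qed.

Lemma unit_transl_commute : commute (a * b^-1) (a^-1 * b).
Proof.
have bV : b^-1 = b * b by exact: mulg1_eq.
have bab : b * a * b = a^-1 * b^-1 * a^-1.
  by move/(congr1 (fun x : G => x^-1)): mul_aba; rewrite !invgM !invgK !mulgA.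
rewrite /commute [in RHS]bV !mulgA -!(mulgA a^-1) bab !mulgA.
by rewrite -invgM sqrg_a invgK.
Qed.

Lemma translD i j k l : tr (i + k)%R (j + l)%R = tr i j * tr k l.
Proof.
rewrite !translE !zexpgD -!mulgA; congr (_ * _); rewrite !mulgA; congr (_ * _).
exact/commute_zexpg/unit_transl_commute.
Qed.

Lemma transl00 : tr 0%R 0%R = 1. Proof. by rewrite translE mulg1. Qed.

Lemma translN i j : tr (- i)%R (- j)%R = (tr i j)^-1.
Proof. by apply/esym/mulg1_eq; rewrite -translD !subrr transl00. Qed.

Lemma translC i j k l : commute (tr i j) (tr k l).
Proof. by rewrite /commute -!translD addrC (addrC j). Qed.

Lemma translZ i j k : tr (i * k)%R (j * k)%R = zexpg (tr i j) k.
Proof.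
have uv := commute_zexpg i j unit_transl_commute.
by rewrite !translE (zexpgMl _ uv) !zexpgM.
Qed.

Lemma translX i j n : tr (i * n%:Z)%R (j * n%:Z)%R = tr i j ^+ n.
Proof. exact: translZ. Qed.

(** Conjugation by a is multiplication by w: w (i - j w) = j + (i + j) w. *)
Lemma translJ i j : tr i j ^ a = tr j (- i - j)%R.
Proof.
rewrite !translE conjMg !zexpgJ unit_translJl unit_translJr.
have uv := unit_transl_commute.
rewrite (zexpgMl _ (commuteV uv)) !zexpVg zexpgD !zexpgN !mulgA; congr (_ * _).
exact: commute_sym (commuteV (commute_zexpg _ _ uv)).
Qed.

Lemma transl10 : tr 1%R 0%R = a * b^-1. Proof. by rewrite translE mulg1. Qed.

Lemma transl01 : tr 0%R 1%R = a^-1 * b. Proof. by rewrite translE mul1g. Qed.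

Lemma transl_nat (i j : nat) :
  tr i j = (a * b^-1) ^+ i * (a^-1 * b) ^+ j.
Proof. exact: translE. Qed.

(** The affine maps z |-> w^k z + c, with c = i - j w. *)
Definition affine_form (x : G) :=
  exists (i j : int) (k : nat), x = tr i j * a ^+ k.

Lemma affine_formMa x : affine_form x -> affine_form (x * a).
Proof.
by case=> i [j [k ->]]; exists i, j, k.+1; rewrite expgSr mulgA.
Qed.

Lemma affine_formMtr x i j : affine_form x -> affine_form (x * tr i j).
Proof.
case=> i' [j' [k ->]]; elim: k => [|k IHk] in i j *.
  by exists (i' + i)%R, (j' + j)%R, 0; rewrite translD expg0 !mulg1.
have atr : a * tr i j = tr (- i - j)%R i * a.
  by rewrite [RHS]conjgC translJ; congr (_ * tr _ _); ring.
rewrite expgSr -!mulgA atr !mulgA.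
exact/affine_formMa/IHk.
Qed.

(** b is the rotation a followed by a unit translation. *)
Lemma affine_formMb x : affine_form x -> affine_form (x * b).
Proof.
have -> : b = a * tr 0 1 by rewrite transl01 mulVKg.
by rewrite mulgA => /affine_formMa/affine_formMtr.
Qed.

Lemma affine_formMV x :
  affine_form x -> affine_form (x * a^-1) /\ affine_form (x * b^-1).
Proof.
move=> fx.
have -> : b^-1 = b * b by exact: mulg1_eq.
by rewrite -sqrg_a !mulgA; split;
  do 2?[apply: affine_formMa|apply: affine_formMb].
Qed.

Section Relator.
Variables s1 s2 : nat.
Hypothesis rel : (a * b^-1) ^+ s1 * (a^-1 * b) ^+ s2 = 1.

(** The left-hand side is the multiple (k + l w) (s1 - s2 w) of alpha, and the
    conjugate by a of a relation is a relation. *)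
Lemma transl_in_lattice (k l : int) :
  tr (s1%:Z * k + s2%:Z * l)%R (s2%:Z * k - (s1%:Z + s2%:Z) * l)%R = 1.
Proof.
have tr1 : tr s1 s2 = 1 by rewrite transl_nat.
have tr2 : tr s2 (- s1%:Z - s2%:Z)%R = 1 by rewrite -translJ tr1 conj1g.
rewrite (_ : - _ = (- s1%:Z - s2%:Z) * l)%R; last by ring.
by rewrite translD !translZ tr1 tr2 !zexp1g mulg1.
Qed.
End Relator.
End Translations.

(** * The ideal generated by alpha *)

(** Membership of i - j w in the ideal of the Eisenstein integers generated by
    alpha = s1 - s2 w; k + l w is the cofactor. *)
Definition in_lattice (s1 s2 : nat) (i j : int) : Prop :=
  exists k l : int,
    (i = s1%:Z * k + s2%:Z * l /\ j = s2%:Z * k - (s1%:Z + s2%:Z) * l)%R.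

Section Lattice.
Local Open Scope ring_scope.
Variables (g p q : nat) (r t : int).
Hypotheses (g_gt0 : (0 < g)%N) (bez : r * p%:Z + t * q%:Z = 1).
Let N' := (g * (p ^ 2 + p * q + q ^ 2))%N.
Let inL := in_lattice (g * p) (g * q).

(** Multiplication by beta = p - q w is injective, its determinant being up to
    sign the norm of beta. *)
Lemma norm_form_eq0 (k l : int) :
  p%:Z * k + q%:Z * l = 0 -> q%:Z * k - (p%:Z + q%:Z) * l = 0 ->
  k = 0 /\ l = 0.
Proof.
move=> e1 e2; pose n := (p ^ 2 + p * q + q ^ 2)%N.
have n0 : n%:Z != 0.
  rewrite /n; case: p q bez => [|p'] [|q'] //; rewrite ?mulr0 //; lia.
split; apply: (mulfI n0); rewrite mulr0 /n.
  move: (congr1 ( *%R (p%:Z + q%:Z)) e1) (congr1 ( *%R q%:Z) e2); lia.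
move: (congr1 ( *%R q%:Z) e1) (congr1 ( *%R p%:Z) e2); lia.
Qed.

Lemma syzygy_coprime (k l : int) : p%:Z * k + q%:Z * l = 0 ->
  exists m, k = q%:Z * m /\ l = - p%:Z * m.
Proof.
move=> e; exists (t * k - r * l); split.
  move: (congr1 ( *%R k) bez) (congr1 ( *%R r) e); lia.
move: (congr1 ( *%R l) bez) (congr1 ( *%R t) e); lia.
Qed.

(** The ideal meets the line spanned by v in the multiples of N/g; this gives
    the order of v, and with [in_lattice_proj1] the order of T. *)
Lemma in_lattice0l (n : int) : inL 0 n <-> exists m, n = N'%:Z * m.
Proof.
rewrite /inL /N'; split=> [[k [l [e ->]]]|[m ->]].
  have /syzygy_coprime[m [-> ->]] : p%:Z * k + q%:Z * l = 0.
    by apply: (@mulfI _ g%:Z); [lia | rewrite mulr0; lia].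
  exists m; lia.
exists (q%:Z * m), (- p%:Z * m); split; lia.
Qed.

(** Modulo v only the ideal (s1, s2) = (g) of the integers is left; this gives
    the order of u modulo v. *)
Lemma in_lattice_proj1 (m : int) :
  (exists n, inL m n) <-> exists c, m = g%:Z * c.
Proof.
split=> [[n [k [l [-> _]]]]|[c ->]].
  exists (p%:Z * k + q%:Z * l); lia.
exists (g%:Z * (q%:Z * r * c - (p%:Z + q%:Z) * t * c)), (r * c), (t * c).
split; last by lia.
move: (congr1 ( *%R (g%:Z * c)) bez); lia.
Qed.

(** Cancelling beta: g beta divides beta (m + n w) iff g divides m and n. *)
Lemma in_lattice_mul_beta (m n : int) :
  inL (p%:Z * m + q%:Z * n) (q%:Z * m - (p%:Z + q%:Z) * n) <->
  exists k l, m = g%:Z * k /\ n = g%:Z * l.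
Proof.
split=> [[k [l [e1 e2]]]|[k [l [-> ->]]]]; last first.
  by exists k, l; split; lia.
have [] := @norm_form_eq0 (m - g%:Z * k) (n - g%:Z * l); [lia | lia |].
by move=> em en; exists k, l; split; lia.
Qed.

(** Cancelling g: if g beta divides g (i - j w), then beta divides i - j w, so
    the g-torsion modulo alpha consists of multiples of beta. *)
Lemma in_lattice_div (i j : int) : inL (g%:Z * i) (g%:Z * j) ->
  exists m n, i = p%:Z * m + q%:Z * n /\ j = q%:Z * m - (p%:Z + q%:Z) * n.
Proof.
have g0 : g%:Z != 0 by lia.
case=> k [l [e1 e2]]; exists k, l.
by split; apply: (mulfI g0); lia.
Qed.

(** Modulo alpha, every g (i - j w) is the integer multiple p j - q i of the
    single element g (-t - r w): their difference is an integer multiple of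
    alpha, because r p + t q = 1. *)
Lemma in_lattice_sub_powg (i j : int) :
  inL (g%:Z * i + g%:Z * t * (p%:Z * j - q%:Z * i))
      (g%:Z * j - g%:Z * r * (p%:Z * j - q%:Z * i)).
Proof.
exists (r * i + t * j), 0; split.
  by move: (congr1 ( *%R (g%:Z * i)) bez); lia.
by move: (congr1 ( *%R (g%:Z * j)) bez); lia.
Qed.

End Lattice.

Lemma mulz_eq_le (N k d : int) :
  (0 < N)%R -> (0 < d)%R -> (N * k = d)%R -> (N <= d)%R.
Proof.
move=> N_gt0 d_gt0 e; move: d_gt0; rewrite -e (pmulr_rgt0 _ N_gt0) => k_gt0.
by rewrite ler_peMr -?gtz0_ge1 // ltW.
Qed.

(** 1 + 2 w has norm 3, so alpha divides it only if N divides 3, that is, for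
    the pairs (1,0), (0,1) and (1,1). *)
Lemma in_lattice_1_2 (s1 s2 : nat) :
  (s1, s2) <> (0, 0) -> (s1, s2) <> (1, 0) -> (s1, s2) <> (0, 1) ->
  (s1, s2) <> (1, 1) -> ~ in_lattice s1 s2 1 (- 2%:Z).
Proof.
move=> n00 n10 n01 n11 [k [l [e1 e2]]].
pose N : int := (s1%:Z ^+ 2 + s1%:Z * s2%:Z + s2%:Z ^+ 2)%R.
(* Cramer's rule for the cofactor k + l w. *)
have ek : (N * k = s1%:Z - s2%:Z)%R.
  move: (congr1 ( *%R (s1%:Z + s2%:Z)%R) e1) (congr1 ( *%R s2%:Z) e2).
  by rewrite /N; lia.
have el : (N * l = s2%:Z + 2%:Z * s1%:Z)%R.
  move: (congr1 ( *%R (s2%:Z)%R) e1) (congr1 ( *%R s1%:Z) e2).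
  by rewrite /N; lia.
clear e1 e2.
have s_gt0 : 0 < s1 + s2 by case: (s1) (s2) n00 => [|?] [|?].
have N_gt0 : (0 < N)%R by rewrite /N; clear -s_gt0; nia.
have le2 : (N <= s2%:Z + 2%:Z * s1%:Z)%R by apply: mulz_eq_le el => //; lia.
have [lt12|lt21|e12] := ltngtP s1 s2.
- have le1 : (N <= s2%:Z - s1%:Z)%R.
    by apply: (@mulz_eq_le _ (- k)%R) => //; [lia | rewrite mulrN ek opprB].
  have [s10 s2s2] : s1 = 0 /\ s2 * s2 <= s2.
    by clear -le1 lt12; rewrite /N in le1; split; nia.
  move: n01; rewrite s10; case: (s2) s2s2 lt12 => [|[|n]] //; rewrite s10 //.
  by nia.
- have le1 : (N <= s1%:Z - s2%:Z)%R by apply: mulz_eq_le ek => //; lia.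
  have [s10 s2s2] : s2 = 0 /\ s1 * s1 <= s1.
    by clear -le1 lt21; rewrite /N in le1; split; nia.
  move: n10; rewrite s10; case: (s1) s2s2 lt21 => [|[|n]] //; rewrite s10 //.
  by nia.
have : s1 * s1 <= s1 by clear -le2 e12; rewrite /N e12 in le2 *; nia.
by move: n11 s_gt0; rewrite -e12; case: (s1) => [|[|n]] //; nia.
Qed.

(** * Core-free subgroups of a finite toroidal group *)
Definition core_free (gT : finGroupType) (G H : {group gT}) :=
  forall K : {group gT}, (K <| G -> K \subset H -> K :=: 1)%g.

(** A finite group of affine maps: [memG] says that G is generated by a and the
    translations, [rel] and [ker] that its translations are the Eisenstein
    integers modulo alpha and that no power of a other than 1 is a translation.
    Bezout coefficients r and t witness that p and q are coprime, so that
    g = gcd(s1, s2). *)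
Section FiniteToroidal.
Local Open Scope group_scope.
Variables (gT : finGroupType) (a b : gT) (G : {group gT}).
Variables (s1 s2 g p q : nat) (r t : int).
Hypotheses (a3 : a ^+ 3 = 1) (b3 : b ^+ 3 = 1) (ab3 : (a * b) ^+ 3 = 1).
Hypotheses (g_gt0 : 0 < g) (s1E : s1 = (g * p)%N) (s2E : s2 = (g * q)%N).
Hypothesis bez : (r * p%:Z + t * q%:Z = 1)%R.
Local Notation tr := (transl a b).
Hypothesis rel : (a * b^-1) ^+ s1 * (a^-1 * b) ^+ s2 = 1.
Hypothesis ker : forall i j k,
  tr i j * a ^+ k = 1 -> 3 %| k /\ in_lattice s1 s2 i j.
Hypothesis memG : forall x, x \in G <-> affine_form a b x.

Let trD := translD a3 b3 ab3.
Let trN := translN a3 b3 ab3.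
Let trC := translC a3 b3 ab3.
Let trX := translX a3 b3 ab3.
Let trJ := translJ a3 b3 ab3.

Let T := (<[a * b^-1]> <*> <[a^-1 * b]>)%G.

Lemma zexpg_cycle (x : gT) i : zexpg x i \in <[x]>.
Proof. by case: i => n /=; rewrite ?groupV mem_cycle. Qed.

Lemma mem_tr i j : tr i j \in T.
Proof.
by rewrite translE groupM ?mem_gen // inE zexpg_cycle ?orbT.
Qed.

Lemma memTP x : reflect (exists i j, x = tr i j) (x \in T).
Proof.
apply: (iffP idP) => [|[i [j ->]]]; last exact: mem_tr.
rewrite /= cent_joinEl; last first.
  rewrite cycle_subG; apply/centP => _ /cycleP[n ->].
  exact/commuteX/unit_transl_commute.
case/mulsgP => _ _ /cycleP[m ->] /cycleP[n ->] ->.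
by exists (Posz m), (Posz n); rewrite transl_nat.
Qed.

Lemma tr_eq1 i j : tr i j = 1 <-> in_lattice s1 s2 i j.
Proof.
split=> [e|[k [l [-> ->]]]]; last exact: transl_in_lattice.
by have /ker[] : tr i j * a ^+ 0 = 1 by rewrite e expg0 mulg1.
Qed.

Lemma mem_aG : a \in G.
Proof.
by apply/memG; exists 0%R, 0%R, 1%N; rewrite transl00 // mul1g expg1.
Qed.

Lemma T_sub_G : T \subset G.
Proof.
apply/subsetP => x /memTP[i [j ->]]; apply/memG.
by exists i, j, 0%N; rewrite mulg1.
Qed.

Lemma T_abelian : abelian T.
Proof.
apply/centsP => x /memTP[i [j ->]] y /memTP[k [l ->]]; exact: trC.
Qed.

Lemma a_norm_T : a \in 'N(T).
Proof.
rewrite inE; apply/subsetP => _ /imsetP[x /memTP[i [j ->]] ->].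
by rewrite trJ mem_tr.
Qed.

(** T is abelian and G is generated by T and a, so a subgroup of T is normal in
    G as soon as a normalises it. *)
Lemma normal_in_T (K : {group gT}) : K \subset T -> a \in 'N(K) -> K <| G.
Proof.
move=> KT aK; rewrite /normal (subset_trans KT T_sub_G) /=.
apply/subsetP => x /memG [i [j [k ->]]]; rewrite groupM ?groupX //.
have := sub_abelian_norm T_abelian KT; move/subsetP; apply; exact: mem_tr.
Qed.

Lemma T_normal : T <| G.
Proof. exact/normal_in_T/a_norm_T. Qed.

Lemma a_pow_T k : (a ^+ k \in T) = (3 %| k).
Proof.
apply/idP/idP => [/memTP[i [j e]]|/dvdnP[m ->]].
  have [] // := @ker (- i)%R (- j)%R k; by rewrite e trN mulVg.
by rewrite mulnC expgM a3 expg1n.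
Qed.

Lemma order_a : #[a] = 3.
Proof.
apply: nt_prime_order => //; apply/eqP => a1.
by have := a_pow_T 1; rewrite expg1 a1 group1.
Qed.

Lemma cycle_a_TI : T :&: <[a]> = 1.
Proof.
apply/trivgP/subsetP => _ /setIP[/[swap] /cycleP[k ->]].
by rewrite a_pow_T inE -order_dvdn order_a.
Qed.

Lemma G_eq : G :=: T * <[a]>.
Proof.
apply/setP => x; apply/idP/idP => [/memG [i [j [k ->]]]|].
  by rewrite mem_mulg ?mem_tr ?mem_cycle.
case/mulsgP => _ _ /memTP[i [j ->]] /cycleP[k ->] ->.
by apply/memG; exists i, j, k.
Qed.

Lemma card_G : #|G| = (#|T| * 3)%N.
Proof. by rewrite G_eq TI_cardMg ?cycle_a_TI // -order_a. Qed.

Let N' := (g * (p ^ 2 + p * q + q ^ 2))%N.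

(** The factored form alpha = g beta. *)
Lemma tr_eq1_beta i j : tr i j = 1 <-> in_lattice (g * p) (g * q) i j.
Proof. by rewrite -s1E -s2E; exact: tr_eq1. Qed.

Lemma order_unit_v : #[a^-1 * b] = N'.
Proof.
apply/eqP; rewrite eqn_dvd.
have vX n : (a^-1 * b) ^+ n = tr 0 (Posz n) by rewrite transl_nat mul1g.
apply/andP; split.
  rewrite order_dvdn vX; apply/eqP/tr_eq1_beta/(in_lattice0l g_gt0 bez).
  by exists 1%R; rewrite mulr1.
have := expg_order (a^-1 * b); rewrite vX => /tr_eq1_beta/(in_lattice0l g_gt0 bez).
case=> m e; have : (Posz N' %| Posz #[a^-1 * b])%Z by rewrite e dvdz_mulr.
by [].
Qed.

(** This quotient is cyclic, generated by the image of u, and u^m is a power of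
    v iff g divides m. *)
Lemma card_T_quo : #|T / <[a^-1 * b]>| = g.
Proof.
have vT : a^-1 * b \in T by rewrite -transl01 mem_tr.
have uT : a * b^-1 \in T by rewrite -transl10 mem_tr.
have TN : T \subset 'N(<[a^-1 * b]>).
  by apply: sub_abelian_norm T_abelian _; rewrite cycle_subG.
have -> : T / <[a^-1 * b]> = <[coset <[a^-1 * b]> (a * b^-1)]>.
  rewrite /= quotientYidr ?quotient_cycle ?(subsetP TN) //.
  by apply: subset_trans TN; rewrite cycle_subG.
have uN := subsetP TN _ uT.
rewrite -orderE; apply/eqP; rewrite eqn_dvd.
have key m : coset <[a^-1 * b]> (a * b^-1) ^+ m = 1 <-> g %| m.
  rewrite -morphX //; split.
    move/(coset_idr (groupX m uN))/cycleP => [n e].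
    have /(in_lattice_proj1 g_gt0 bez) :
        exists n', in_lattice (g * p) (g * q) (Posz m) n'.
      exists (- Posz n)%R; apply/tr_eq1_beta.
      rewrite -[Posz m]addr0 -[(- _)%R]add0r.
      rewrite trD -{2}oppr0 trN !transl_nat !expg0 mulg1 mul1g.
      by apply/eqP; rewrite mulg_eq1 invgK e.
    case=> // c e'; have : (Posz g %| Posz m)%Z by rewrite e' dvdz_mulr.
    by [].
  case/dvdnP => c ->.
  have [n /tr_eq1_beta] : exists n', in_lattice (g * p) (g * q) (Posz (c * g)) n'.
    by apply/(in_lattice_proj1 g_gt0 bez); exists (Posz c); lia.
  rewrite translE => /eqP; rewrite mulg_eq1 => /eqP /= ->.
  by apply: coset_id; rewrite groupV zexpg_cycle.
apply/andP; split; first by rewrite order_dvdn; apply/eqP/key.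
by apply/key/expg_order.
Qed.

Lemma card_T : #|T| = (s1 ^ 2 + s1 * s2 + s2 ^ 2)%N.
Proof.
have vT : a^-1 * b \in T by rewrite -transl01 mem_tr.
have TN : <[a^-1 * b]> <| T.
  by rewrite -sub_abelian_normal ?T_abelian // cycle_subG.
have := card_T_quo; rewrite card_quotient ?normal_norm // => ix.
rewrite -(Lagrange (normal_sub TN)) ix -orderE order_unit_v /N' s1E s2E.
lia.
Qed.

Let beta := tr p q.

(** As beta^a is w beta, this product is the translation beta (m + n w). *)
Lemma beta_powE (m n : int) :
  zexpg beta m * zexpg (beta ^ a) n =
  tr (p%:Z * m + q%:Z * n)%R (q%:Z * m - (p%:Z + q%:Z) * n)%R.
Proof.
rewrite /beta trJ -!(translZ a3 b3 ab3) -trD; congr (tr _ _); ring.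
Qed.

Lemma beta_pow_eq1 (m n : int) :
  zexpg beta m * zexpg (beta ^ a) n = 1 <->
  exists k l : int, m = (g%:Z * k)%R /\ n = (g%:Z * l)%R.
Proof.
rewrite beta_powE; split=> [/tr_eq1_beta /(in_lattice_mul_beta g_gt0 bez)//|e].
exact/tr_eq1_beta/(in_lattice_mul_beta g_gt0 bez).
Qed.

Lemma beta_pow_nat m n : beta ^+ m = (beta ^ a) ^+ n -> g %| m /\ g %| n.
Proof.
move=> e; have /beta_pow_eq1[k [l [em en]]] :
    zexpg beta (Posz m) * zexpg (beta ^ a) (- Posz n)%R = 1.
  by rewrite zexpgN /= e mulgV.
have gm : (Posz g %| Posz m)%Z by rewrite em dvdz_mulr.
have gn : (Posz g %| (- Posz n)%R)%Z by rewrite en dvdz_mulr.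
by split=> //; move: gn; rewrite rpredN.
Qed.

Lemma order_beta : #[beta] = g.
Proof.
apply/eqP; rewrite eqn_dvd order_dvdn.
have -> : beta ^+ g = 1.
  have /beta_pow_eq1 :
      exists k l : int, Posz g = (g%:Z * k)%R /\ 0%R = (g%:Z * l)%R.
    by exists 1%R, 0%R; rewrite mulr1 mulr0.
  by rewrite mulg1.
rewrite eqxx /=; apply: (proj1 (@beta_pow_nat #[beta] 0 _)).
by rewrite expg_order.
Qed.

(** A normal subgroup contained in the cyclic group of beta is stable under a;
    but a power of beta that is also a power of beta^a is trivial. *)
Lemma core_free_beta d : d %| g ->
  core_free G <[beta ^+ (g %/ d)]> /\ #|<[beta ^+ (g %/ d)]>| = d.
Proof.
move=> dg; split; last first.
  rewrite -orderE orderXdiv order_beta ?dvdn_div //.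
  by rewrite divnA // mulKn.
move=> K /andP[_ KN] KH; apply/trivgP/subsetP => z zK.
have Kx : K \subset <[beta]> by rewrite (subset_trans KH) // cycle_subG mem_cycle.
have /cycleP[m zE] := subsetP Kx z zK.
have zaK : z ^ a \in K by rewrite memJ_norm // (subsetP KN) // mem_aG.
have /cycleP[n] := subsetP Kx _ zaK.
rewrite zE conjXg => /esym/beta_pow_nat[_ gm].
by rewrite inE -order_dvdn order_beta.
Qed.

(** The group of a has prime order, so a normal subgroup in it other than 1
    contains a.  Then the commutator of a and v lies both in it and in T, hence
    is 1: a fixes v, and the translation 1 + 2 w = v^a v^-1 is trivial. *)
Lemma core_free_cycle_a : ~ in_lattice s1 s2 1 (- 2%:Z)%R -> core_free G <[a]>.
Proof.
move=> not12 K /andP[_ KN] Ka.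
apply/eqP; apply: contraT => ntK.
have aK : a \in K.
  have -> : K :=: <[a]>; last exact: cycle_id.
  apply/eqP; rewrite eqEcard Ka -orderE order_a.
  have := cardSg Ka; rewrite -orderE order_a.
  have : #|K| != 1%N by rewrite -trivg_card1.
  by case: #|K| => [|[|[|[|n]]]].
have /[1!cycle_a_TI] /set1P cav : [~ a, tr 0 1] \in T :&: <[a]>.
  rewrite inE; apply/andP; split.
    by rewrite commgEr groupM ?memJ_norm ?a_norm_T ?groupV ?mem_tr.
  rewrite (subsetP Ka) // commgEl groupM ?groupV // memJ_norm //.
  exact/(subsetP KN)/(subsetP T_sub_G)/mem_tr.
case: not12; apply/tr_eq1.
have /conjg_fixP : [~ tr 0 1, a] == 1 by rewrite -invgR cav invg1.
rewrite trJ => e.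
have -> : (- 2%:Z = (- 0 - 1) + - 1)%R by [].
by rewrite -[1%R]addr0 -[in X in tr X _]oppr0 trD trN -e mulgV.
Qed.

Lemma mem_T_powg y : y \in T -> y ^+ g = 1 -> y \in <[beta]> <*> <[beta ^ a]>.
Proof.
case/memTP => i [j ->]; rewrite -trX => /tr_eq1_beta.
rewrite mulrC (mulrC j) => /(in_lattice_div g_gt0 bez)[m [n [-> ->]]].
by rewrite -beta_powE groupM // mem_gen // inE zexpg_cycle ?orbT.
Qed.

(* A generator of the subgroup of g-th powers; Bezout makes it cyclic. *)
Let theta := tr (- t * g%:Z)%R (r * g%:Z)%R.

Lemma T_powg_cyclic y : y \in T -> y ^+ g \in <[theta]>.
Proof.
case/memTP => i [j ->]; rewrite -trX.
suff -> : tr (i * g%:Z)%R (j * g%:Z)%R = zexpg theta (p%:Z * j - q%:Z * i)%R.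
  exact: zexpg_cycle.
apply/eqP; rewrite -divg_eq1 -(translZ a3 b3 ab3) -trN -trD; apply/eqP/tr_eq1_beta.
have := in_lattice_sub_powg g_gt0 bez i j.
by congr (in_lattice _ _ _ _); ring.
Qed.

Lemma cycle_theta_normal : <[theta]> <| G.
Proof.
apply: normal_in_T; first by rewrite cycle_subG mem_tr.
rewrite inE -cycleJ cycle_subG.
have -> : theta ^ a = (tr (- t)%R r ^ a) ^+ g by rewrite -conjXg -trX.
by rewrite T_powg_cyclic // memJ_norm ?a_norm_T ?mem_tr.
Qed.

Section CoreFree.
Variable H : {group gT}.
Hypothesis cfH : core_free G H.

Lemma core_free_sub_T : H \subset T -> #|H| %| g.
Proof.
move=> HT.
have Hg h : h \in H -> h ^+ g = 1.
  move=> hH; apply/eqP; rewrite -cycle_eq1; apply/eqP.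
  apply: (cfH (K := <[h ^+ g]>%G)); last by rewrite cycle_subG groupX.
  apply: char_normal_trans cycle_theta_normal.
  rewrite sub_cyclic_char ?cycle_cyclic // cycle_subG.
  by rewrite T_powg_cyclic ?(subsetP HT).
(* For y in H and in H^a, say y = z^a, the relation 1 + w + w^2 = 0 puts
   y^a = (z y)^-1 back in H. *)
have TI : H :&: (H :^ a) = 1.
  have Hint : H :&: (H :^ a)%G \subset T by rewrite subIset ?HT.
  apply: (cfH (K := (H :&: H :^ a)%G)); last exact: subsetIl.
  apply: (normal_in_T Hint).
  rewrite inE; apply/subsetP => _ /imsetP[y /setIP[yH yHa] ->].
  rewrite inE memJ_conjg yH andbT.
  have /imsetP[z zH yE] := yHa.
  have /memTP[i [j zE]] := subsetP HT _ zH.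
  have -> : y ^ a = (z * y)^-1.
    rewrite yE zE !trJ -trD -trN; congr (tr _ _); ring.
  by rewrite groupV groupM.
have sub : H * (H :^ a) \subset <[beta]> <*> <[beta ^ a]>.
  apply/subsetP => _ /mulsgP[y z yH /imsetP[z' z'H ->] ->].
  have yT := subsetP HT _ yH; have zT := subsetP HT _ z'H.
  have zaT : z' ^ a \in T by rewrite memJ_norm ?a_norm_T.
  by rewrite groupM // mem_T_powg -?conjXg ?Hg // conj1g.
have cHH : H :^ a \subset 'C(H).
  apply: subset_trans (centS HT).
  apply: subset_trans (_ : T \subset _); last exact: T_abelian.
  by rewrite -(normP a_norm_T) conjSg.
have sub2 : H <*> (H :^ a)%G \subset <[beta]> <*> <[beta ^ a]>.
  by rewrite cent_joinEr.
have := cardSg sub2.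
rewrite /= cent_joinEr // TI_cardMg // cardJg.
have cxx : <[beta ^ a]> \subset 'C(<[beta]>).
  rewrite cycle_subG; apply/centP => _ /cycleP[n ->].
  by apply: commuteX; rewrite /beta trJ; exact: trC.
have d1 : #|<[beta]> <*> <[beta ^ a]>| %| g ^ 2.
  rewrite cent_joinEr //; apply: (@dvdn_trans (#|<[beta]>| * #|<[beta ^ a]>|)).
    by rewrite mul_cardG dvdn_mulr.
  by rewrite -!orderE orderJ order_beta.
by move=> d2; have := dvdn_trans d2 d1; rewrite mulnn dvdn_pexp2r.
Qed.

(** An element of H outside T is a translation times a power a^k that generates
    the group of a; hence whatever H and T normalise, a does as well. *)
Lemma core_free_nsub_T : H \subset G -> ~~ (H \subset T) -> #|H| = 3.
Proof.
move=> HG HnT.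
have [h hH hnT] := subsetPn HnT.
have /memG [i [j [k hE]]] := subsetP HG _ hH.
have k3 : ~~ (3 %| k).
  by apply: contra hnT => k3; rewrite hE groupM ?mem_tr ?a_pow_T.
have TI : H :&: T = 1.
  have KT : (H :&: T)%G \subset T by rewrite subsetIr.
  apply: (cfH (K := (H :&: T)%G)); last exact: subsetIl.
  apply: (normal_in_T KT).
  have akN : a ^+ k \in 'N(H :&: T).
    have -> : a ^+ k = (tr i j)^-1 * h by rewrite hE mulKg.
    rewrite groupM ?groupV //.
      have := sub_abelian_norm T_abelian KT; move/subsetP; apply; exact: mem_tr.
    have hN : h \in 'N(T).
      by rewrite (subsetP (normal_norm T_normal)) // (subsetP HG).
    by rewrite inE conjIg conjGid // (normP hN).
  have -> : a \in 'N(H :&: T) = (<[a]> \subset 'N(H :&: T)).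
    by rewrite cycle_subG.
  have : generator <[a]> (a ^+ k).
    by rewrite generator_coprime order_a prime_coprime.
  by rewrite /generator => /eqP->; rewrite cycle_subG.
have cardHT : #|H| %| 3.
  have sub : H <*> T \subset G by rewrite join_subG HG T_sub_G.
  have HN : H \subset 'N(T).
    by rewrite (subset_trans HG) // normal_norm ?T_normal.
  have := cardSg sub.
  by rewrite /= norm_joinEl // TI_cardMg // card_G mulnC dvdn_pmul2l.
move: cardHT; rewrite dvdn_divisors // !inE => /orP[|/eqP //].
rewrite -trivg_card1 => /eqP H1; case/negP: HnT; rewrite H1.
exact: sub1G.
Qed.

End CoreFree.

Let N := (s1 ^ 2 + s1 * s2 + s2 ^ 2)%N.

Lemma core_free_index n : ~ in_lattice s1 s2 1 (- 2%:Z)%R ->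
  (exists H : {group gT}, [/\ H \subset G, core_free G H & #|G : H| = n]) <->
  n = N \/ exists d, d %| g /\ n = (3 * N) %/ d.
Proof.
move=> not12; have cardG : #|G| = (3 * N)%N by rewrite card_G card_T mulnC.
have indexE (H : {group gT}) : H \subset G -> #|G : H| = (3 * N) %/ #|H|.
  by move=> HG; rewrite -divgS // cardG.
split=> [[H [HG cfH <-]]|[->|[d [dg ->]]]].
- have [HT|HnT] := boolP (H \subset T).
    by right; exists #|H|; rewrite indexE // core_free_sub_T.
  by left; rewrite indexE // (core_free_nsub_T cfH) // mulKn.
- have aG : <[a]> \subset G by rewrite cycle_subG mem_aG.
  exists <[a]>%G; split=> //; first exact: core_free_cycle_a.
  by rewrite indexE // -orderE order_a mulKn.
have [cf card] := core_free_beta dg.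
have HG : <[beta ^+ (g %/ d)]> \subset G.
  by rewrite cycle_subG groupX // (subsetP T_sub_G) ?mem_tr.
by exists <[beta ^+ (g %/ d)]>%G; rewrite indexE // card.
Qed.

End FiniteToroidal.

(** * Homomorphisms from a presented group *)
Section GroupMorphism.
Local Open Scope group_scope.
Variables (G H : groupType) (f : {multiplicative G -> H}).

Lemma multiplicative1 : f 1 = 1.
Proof. by apply: (@mulgI _ (f 1)); rewrite -gmulfM !mulg1. Qed.

(** Between groups a multiplicative map preserves 1, hence inverses; this
    packaging makes the corresponding general lemmas applicable. *)
Definition umagma_morphism_of : UMagmaMorphism.type G H :=
  HB.pack (f : G -> H)
    (isUMagmaMorphism.Build G H f (multiplicative1, gmulfM (s := f))).

Lemma multiplicativeX x n : f (x ^+ n) = f x ^+ n.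
Proof. exact: (gmulfXn umagma_morphism_of). Qed.

Lemma multiplicative_zexpg x i : f (zexpg x i) = zexpg (f x) i.
Proof.
case: i => n; first exact: multiplicativeX.
exact: (gmulfXVn umagma_morphism_of).
Qed.

Lemma multiplicative_transl x y i j :
  f (transl x y i j) = transl (f x) (f y) i j.
Proof.
rewrite !translE gmulfM !multiplicative_zexpg !gmulfM.
by rewrite !(gmulfV umagma_morphism_of).
Qed.

End GroupMorphism.

Section WordValue.
Local Open Scope group_scope.
Variables (X : choiceType) (K : groupType) (h : X -> K).

Definition letter_value (l : X * bool) : K :=
  if l.2 then (h l.1)^-1 else h l.1.

Definition wvalue (w : word X) : K := \prod_(l <- w) letter_value l.

Lemma wvalue_cat w1 w2 : wvalue (w1 ++ w2) = wvalue w1 * wvalue w2.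
Proof. by rewrite /wvalue big_cat. Qed.

Lemma wvalue_gen x : wvalue (wgen x) = h x.
Proof. by rewrite /wvalue big_seq1. Qed.

Lemma wvalue_inv w : wvalue (winv w) = (wvalue w)^-1.
Proof.
elim: w => [|[x e] w IHw]; first by rewrite /wvalue !big_nil invg1.
rewrite -cat1s winv_cat !wvalue_cat IHw invgM; congr (_ * _).
by rewrite /wvalue !big_seq1 /letter_value; case: e; rewrite ?invgK.
Qed.

Lemma wvalue_exp w n : wvalue (wexp w n) = wvalue w ^+ n.
Proof.
elim: n => [|n IHn]; first by rewrite /wvalue big_nil.
by rewrite expgS -IHn -wvalue_cat.
Qed.

Section Lift.
Variable R : seq (word X).
Hypothesis valR : forall r, r \in R -> wvalue r = 1.

Lemma wvalue_congr w1 w2 : wcongr R w1 w2 -> wvalue w1 = wvalue w2.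
Proof.
elim=> {w1 w2} //=.
- by move=> w1 w2 w3 _ -> _ ->.
- by move=> w1 w1' w2 w2' _ e1 _ e2; rewrite !wvalue_cat e1 e2.
- move=> x e; rewrite /wvalue big_nil big_cons big_seq1 /letter_value.
  by case: e; rewrite /= ?mulgV ?mulVg.
- by move=> r /valR->; rewrite /wvalue big_nil.
Qed.

(** The existence half of the universal property of a presented group. *)
Lemma presented_lift :
  exists phi : {multiplicative presented R -> K},
    forall w, phi (\pi_(presented R)%qT w) = wvalue w.
Proof.
pose phi (x : presented R) := wvalue (repr x).
have phiE w : phi (\pi_(presented R)%qT w) = wvalue w.
  exact/wvalue_congr/wcongr_repr.
have phiM : {morph phi : x y / x * y}.
  move=> x y; have [w1 ->] := presentedP x; have [w2 ->] := presentedP y.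
  by rewrite [_ * _]pmul_pi !phiE wvalue_cat.
pose m := isMultiplicative.Build _ _ phi phiM.
pose f : {multiplicative presented R -> K} := HB.pack phi m.
by exists f.
Qed.

End Lift.
End WordValue.

(** * Faithful transitive actions and core-free subgroups *)
Section Degrees.
Local Open Scope group_scope.
Variable G : groupType.

Section CosetAction.
Variables (gT : finGroupType) (phi : {multiplicative G -> gT}).
Hypothesis phi_inj : injective phi.
Variables Gam H : {group gT}.
Hypothesis memGam : forall x, x \in Gam <-> exists g, phi g = x.
Hypotheses (HG : H \subset Gam) (cfH : core_free Gam H).

Let S := {A : {set gT} | A \in rcosets H Gam}.

Lemma coset_act_subproof (g : G) (A : S) : val A :* phi g \in rcosets H Gam.
Proof.
have /rcosetsP[x xG ->] := valP A.
rewrite -rcosetM mem_rcosets; apply/mulsgP; exists 1 (x * phi g) => //.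
  by rewrite groupM //; apply/memGam; exists g.
by rewrite mul1g.
Qed.

Definition coset_act g (A : S) : S :=
  Sub (val A :* phi g) (coset_act_subproof g A).

Lemma coset_act_inj g : injective (coset_act g).
Proof.
by move=> A B /(congr1 val) /rcoset_inj e; apply: val_inj.
Qed.

Definition coset_perm g : {perm S} := perm (@coset_act_inj g).

Lemma coset_permM : {morph coset_perm : g h / g * h}.
Proof.
move=> g h; apply/permP => A; rewrite permM !permE; apply: val_inj.
by rewrite /= gmulfM rcosetM.
Qed.
HB.instance Definition _ := isMultiplicative.Build _ _ coset_perm coset_permM.

(** The action on right cosets is faithful because its kernel, the intersection
    of the conjugates of H, is normal and contained in H. *)
Lemma core_free_degree : faithful_transitive_degree G #|Gam : H|.
Proof.
exists S, coset_perm; split.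
- by rewrite card_sig.
- exact: indexg_gt0.
- apply: (gmulf_inj (f := umagma_morphism_of coset_perm)) => g.
  rewrite -[umagma_morphism_of _ g]/(coset_perm g) => g1.
  apply: phi_inj; rewrite multiplicative1; apply/set1gP.
  rewrite -(cfH (gcore_normal HG) (gcore_sub _ _)).
  apply/bigcapP => x xG; rewrite mem_conjg.
  have HxS : H :* x \in rcosets H Gam by rewrite mem_rcosets mulSGid.
  have /(congr1 val) /= e : coset_perm g (Sub (H :* x) HxS) = Sub (H :* x) HxS.
    by rewrite g1 perm1.
  rewrite permE /= in e.
  have : x * phi g \in H :* x by rewrite -e mem_rcoset mulgK rcoset_refl.
  by rewrite mem_rcoset conjgE invgK mulgA.
move=> A B.
have /rcosetsP[x xG eA] := valP A; have /rcosetsP[y yG eB] := valP B.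
have /memGam[g gE] : x^-1 * y \in Gam by rewrite groupM ?groupV.
exists g; rewrite permE; apply: val_inj.
by rewrite /= eA eB gE -rcosetM mulKVg.
Qed.

End CosetAction.

(** A point stabiliser is core-free: a normal subgroup fixing one point fixes
    every point, the action being transitive. *)
Lemma degree_core_free n : faithful_transitive_degree G n ->
  exists (gT : finGroupType) (phi : {multiplicative G -> gT}),
    injective phi /\
    forall Gam : {group gT}, (forall x, x \in Gam <-> exists g, phi g = x) ->
    exists H : {group gT}, [/\ H \subset Gam, core_free Gam H & #|Gam : H| = n].
Proof.
case=> S [f [cardS n_gt0 f_inj ftrans]]; exists {perm S}, f; split=> // Gam memG.
have [x0 _] : exists x0 : S, x0 \in S by apply/card_gt0P; rewrite cardS.
exists ('C_Gam[x0 | 'P])%G; split; first exact: subsetIl.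
  move=> K /andP[_ KN] Kx; apply/trivgP/subsetP => z zK; rewrite inE.
  apply/eqP/permP => y; rewrite perm1.
  have [g <-] := ftrans x0 y.
  have fgG : f g \in Gam by apply/memG; exists g.
  have : z ^ (f g)^-1 \in K by rewrite memJ_norm // groupV (subsetP KN).
  move/(subsetP Kx); case/setIP=> _ /astab1P /= e.
  rewrite -permM; have -> : f g * z = z ^ (f g)^-1 * f g by rewrite -conjgCV.
  by rewrite permM; congr (f g _).
rewrite -card_orbit -cardS -cardsT; congr #|pred_of_set _|.
apply/setP => y; rewrite inE; apply/orbitP.
have [g <-] := ftrans x0 y; exists (f g) => //.
by apply/memG; exists g.
Qed.

Lemma image_group (gT : finGroupType) (phi : {multiplicative G -> gT}) :
  exists Gam : {group gT}, forall x, x \in Gam <-> exists g, phi g = x.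
Proof.
pose A := [set x | `[< exists g, phi g = x >]].
have AG : group_set A.
  apply/group_setP; split.
    by rewrite inE; apply/asboolP; exists 1; rewrite multiplicative1.
  move=> x y; rewrite !inE => /asboolP[g <-] /asboolP[h <-].
  by apply/asboolP; exists (g * h); rewrite gmulfM.
by exists (Group AG) => x; rewrite inE; split=> /asboolP.
Qed.

End Degrees.

(** * A finite model *)
Lemma pair_mulrn (U W : zmodType) (z : U) (w : W) m :
  ((z, w) *+ m = (z *+ m, w *+ m))%R.
Proof. by elim: m => [|m IHm] //; rewrite !mulrS IHm. Qed.

Lemma pair_comb_eq0 (U W : zmodType) (x x' : U) (y y' : W) (i j : int) :
  ((x, y) *~ i + (x', y') *~ j = 0 ->
   x *~ i + x' *~ j = 0 /\ y *~ i + y' *~ j = 0)%R.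
Proof.
have pz (z : U) (w : W) n : ((z, w) *~ n = (z *~ n, w *~ n))%R.
  by case: n => n; rewrite ?NegzE ?mulrNz -!pmulrn pair_mulrn.
by rewrite !pz => -[].
Qed.

(** The affine group of Z[w]/(N), in which k + l w is represented by the pair
    (k, l).  Instead of forming the quotient of Z[w] by alpha, the model embeds
    it in Z[w]/(N) by multiplication by N/alpha, the conjugate of alpha. *)
Section Model.
Local Open Scope group_scope.
Variables s1 s2 : nat.
Let N := (s1 ^ 2 + s1 * s2 + s2 ^ 2)%N.
Hypothesis N_gt1 : 1 < N.
Let V := ('Z_N * 'Z_N)%type.

(** w (k + l w) = - l + (k - l) w. *)
Definition omega_mul (z : V) : V := (- z.2, z.1 - z.2)%R.

Lemma omega_mul3 z : omega_mul (omega_mul (omega_mul z)) = z.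
Proof. case: z => k l; congr (_, _); rewrite /=; ring. Qed.

Lemma omega_mul_inj : injective omega_mul.
Proof.
by apply: (@can_inj _ _ _ (omega_mul \o omega_mul)) => z; exact: omega_mul3.
Qed.

Definition model_a : {perm V} := perm omega_mul_inj.

Definition shift (c : V) : {perm V} := perm (@addIr V c).

Lemma model_aE z : model_a z = omega_mul z. Proof. exact: permE. Qed.
Lemma shiftE c z : shift c z = (z + c)%R. Proof. exact: permE. Qed.

Lemma shiftD c d : shift (c + d)%R = shift c * shift d.
Proof. by apply/permP => z; rewrite permM !shiftE addrA. Qed.

Lemma shift0 : shift 0%R = 1.
Proof. by apply/permP => z; rewrite shiftE perm1 addr0. Qed.

Lemma zexpg_shift c i : zexpg (shift c) i = shift (c *~ i)%R.
Proof.
have shX n : shift c ^+ n = shift (c *+ n)%R.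
  by elim: n => [|n IHn]; rewrite ?mulr0n ?shift0 // expgS IHn -shiftD mulrS.
case: i => n; first exact: shX.
by rewrite /= shX; apply: mulg1_eq; rewrite -shiftD NegzE mulrNz subrr shift0.
Qed.

(** The conjugate of alpha = s1 - s2 w, namely (s1 + s2) + s2 w, and its product
    by - w: the images of the translations u = 1 and v = - w. *)
Definition vec_u : V := ((s1 + s2)%N%:R, s2%:R)%R.
Definition vec_v : V := (s2%:R, - s1%:R)%R.
Definition model_b : {perm V} := model_a * shift vec_v.

Lemma model_v : model_a^-1 * model_b = shift vec_v.
Proof. by rewrite mulKg. Qed.

Lemma model_u : model_a * model_b^-1 = shift vec_u.
Proof.
apply/eqP; rewrite divg_eq; apply/eqP/permP => -[k l].
rewrite !permM !shiftE !model_aE /omega_mul /=.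
by congr (_, _); rewrite /= ?natrD; ring.
Qed.

Lemma model_transl i j :
  transl model_a model_b i j = shift (vec_u *~ i + vec_v *~ j)%R.
Proof. by rewrite translE model_u model_v !zexpg_shift shiftD. Qed.

Lemma model_a3 : model_a ^+ 3 = 1.
Proof. by apply/permP => z; rewrite !permM !model_aE omega_mul3 perm1. Qed.

Lemma model_b3 : model_b ^+ 3 = 1.
Proof.
apply/permP => -[k l]; rewrite perm1 !(shiftE, model_aE, permM) /omega_mul /=.
by congr (_, _); rewrite /=; ring.
Qed.

Lemma model_ab3 : (model_a * model_b) ^+ 3 = 1.
Proof.
apply/permP => -[k l]; rewrite perm1 !(shiftE, model_aE, permM) /omega_mul /=.
by congr (_, _); rewrite /=; ring.
Qed.

Lemma model_rel :
  (model_a * model_b^-1) ^+ s1 * (model_a^-1 * model_b) ^+ s2 = 1.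
Proof.
rewrite -transl_nat model_transl -shift0; congr shift.
have -> : (vec_u *~ s1 + vec_v *~ s2 = (N%:R, 0))%R.
  rewrite -!pmulrn pair_mulrn pair_mulrn; congr (_, _).
    by rewrite /= -!mulrnA -natrD; congr (_%:R)%R; rewrite /N; lia.
  by rewrite /= mulNrn -!mulrnA mulnC subrr.
by rewrite pchar_Zp.
Qed.

Lemma Zp_intr_eq0 (i : int) :
  (i%:~R = 0 :> 'Z_N)%R <-> exists k, (i = N%:Z * k)%R.
Proof.
have natE (n : nat) : (n%:R = 0 :> 'Z_N)%R <-> N %| n.
  split=> [/(congr1 val)|/dvdnP[m ->]]; last by rewrite natrM pchar_Zp // mulr0.
  by rewrite /= val_Zp_nat // => /eqP.
split=> [|[k ->]]; last by rewrite intrM -pmulrn pchar_Zp // mul0r.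
case: i => n.
  rewrite -pmulrn => /natE/dvdnP[m ->]; exists (Posz m); lia.
rewrite NegzE mulrNz -pmulrn => /eqP; rewrite oppr_eq0 => /eqP/natE/dvdnP[m ->].
exists (- m%:Z)%R; lia.
Qed.

(** A product of a translation and a power of a that acts trivially fixes 0, so
    both factors are trivial.  The components c1, c2 of the translation are
    those of N/alpha (i - j w); dividing them by N gives the cofactor k1 + l1 w. *)
Lemma model_ker i j k :
  transl model_a model_b i j * model_a ^+ k = 1 ->
  3 %| k /\ in_lattice s1 s2 i j.
Proof.
rewrite model_transl => e1.
have fix0 n : (model_a ^+ n) 0%R = 0%R.
  elim: n => [|n IHn]; first by rewrite perm1.
  by rewrite expgSr permM IHn model_aE /omega_mul /= subrr oppr0.
have c0 : (vec_u *~ i + vec_v *~ j = 0)%R.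
  apply: (@perm_inj _ (model_a ^+ k)); rewrite fix0.
  by have /permP/(_ 0%R) := e1; rewrite permM shiftE add0r perm1.
split.
  have -> : 3 %| k = (k %% 3 == 0) by [].
  have {e1} : model_a ^+ (k %% 3) = 1.
    move: e1; rewrite c0 shift0 mul1g {1}(divn_eq k 3) expgD mulnC expgM.
    by rewrite model_a3 expg1n mul1g.
  have : k %% 3 < 3 by rewrite ltn_mod.
  have a10 : model_a (1, 0)%R = (0, 1)%R.
    by rewrite model_aE /omega_mul /= oppr0 addr0.
  have a01 : model_a (0, 1)%R = (- 1, - 1)%R.
    by rewrite model_aE /omega_mul /= sub0r.
  case: (k %% 3) => [|[|[|m]]] // _ /permP/(_ (1, 0)%R).
    rewrite perm1 expg1 a10 => /(congr1 fst)/eqP.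
    by rewrite /fst eq_sym oner_eq0.
  rewrite perm1 permM a10 a01 => /(congr1 snd)/eqP.
  by rewrite /snd oppr_eq0 oner_eq0.
have [c1 c2] := pair_comb_eq0 c0.
have /Zp_intr_eq0[k1 e1'] :
    (((s1 + s2)%N%:Z * i + s2%:Z * j)%:~R = 0 :> 'Z_N)%R.
  by rewrite -c1 intrD !intrM -!pmulrn !mulrzr.
have /Zp_intr_eq0[l1 e2'] : ((s2%:Z * i - s1%:Z * j)%:~R = 0 :> 'Z_N)%R.
  by rewrite -c2 intrB !intrM -!pmulrn !mulrzr mulNrz.
have N0 : (N%:Z != 0)%R by clear -N_gt1; lia.
exists k1, l1; split; apply: (mulfI N0).
  move: (congr1 ( *%R s1%:Z)%R e1') (congr1 ( *%R s2%:Z)%R e2').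
  by rewrite /N; clear; lia.
move: (congr1 ( *%R s2%:Z)%R e1') (congr1 ( *%R (s1%:Z + s2%:Z))%R e2').
by rewrite /N; clear; lia.
Qed.
End Model.

(** * The rotation group of the hypermap *)
Section Hypermap.
Local Open Scope group_scope.
Variables s1 s2 : nat.
Let G := hypermap333_group s1 s2.
Let piG (w : word bool) : G :=
  \pi_(presented (hypermap333_relators s1 s2))%qT w.
Let gen (x : bool) : G := piG (wgen x).
Let ga := gen true.
Let gb := gen false.

Lemma hypermap_relatorsP (K : groupType) (h : bool -> K) :
  (forall r, r \in hypermap333_relators s1 s2 -> wvalue h r = 1) <->
  [/\ h true ^+ 3 = 1, h false ^+ 3 = 1, (h true * h false) ^+ 3 = 1 &
      (h true * (h false)^-1) ^+ s1 * ((h true)^-1 * h false) ^+ s2 = 1].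
Proof.
have val := (wvalue_cat, wvalue_exp, wvalue_inv, wvalue_gen).
split=> [rel|[e1 e2 e3 e4] r].
  split.
  - by have := rel (wexp (wgen true) 3); rewrite !val; apply; rewrite mem_head.
  - have := rel (wexp (wgen false) 3); rewrite !val; apply.
    by rewrite !inE eqxx ?orbT.
  - have := rel (wexp (wgen true ++ wgen false) 3); rewrite !val; apply.
    by rewrite !inE eqxx ?orbT.
  have := rel (wexp (wgen true ++ winv (wgen false)) s1 ++
               wexp (winv (wgen true) ++ wgen false) s2).
  by rewrite !val; apply; rewrite !inE eqxx ?orbT.
by rewrite !inE => /or4P[] /eqP->; rewrite !val.
Qed.

Lemma piM w1 w2 : piG w1 * piG w2 = piG (w1 ++ w2).
Proof. exact: pmul_pi. Qed.

Lemma piV w : (piG w)^-1 = piG (winv w).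
Proof. exact: pinv_pi. Qed.

Lemma pi_wvalue w : piG w = wvalue gen w.
Proof.
elim: w => [|[x e] w IHw]; first by rewrite /wvalue big_nil.
rewrite -cat1s -piM wvalue_cat IHw; congr (_ * _).
rewrite /wvalue big_seq1 /letter_value.
by case: e => //=; rewrite piV.
Qed.

Lemma hypermap_rel : [/\ ga ^+ 3 = 1, gb ^+ 3 = 1, (ga * gb) ^+ 3 = 1 &
  (ga * gb^-1) ^+ s1 * (ga^-1 * gb) ^+ s2 = 1].
Proof.
apply/(hypermap_relatorsP gen) => r rR; rewrite -pi_wvalue.
exact/presented_eqP/wcongr_relator.
Qed.

Lemma hypermap_affine x : affine_form ga gb x.
Proof.
have [a3 b3 ab3 _] := hypermap_rel.
have [w ->] := presentedP x; rewrite -/(piG w).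
elim/last_ind: w => [|w [y e] IHw].
  by exists 0%R, 0%R, 0%N; rewrite transl00 mulg1.
have letterE : piG [:: (y, e)] = letter_value gen (y, e).
  by rewrite pi_wvalue /wvalue big_seq1.
rewrite -cats1 -piM letterE /letter_value /=.
have [fa fb] := affine_formMV a3 b3 ab3 IHw.
by case: e y letterE => [] [] _ //; [exact: affine_formMa | exact: affine_formMb].
Qed.

Hypothesis N_gt1 : 1 < s1 ^ 2 + s1 * s2 + s2 ^ 2.

Lemma exists_model : exists (gT : finGroupType) (phi : {multiplicative G -> gT}),
  forall i j k, transl (phi ga) (phi gb) i j * phi ga ^+ k = 1 ->
    3 %| k /\ in_lattice s1 s2 i j.
Proof.
pose h (x : bool) := if x then model_a s1 s2 else model_b s1 s2.
have [|phi phiE] := @presented_lift _ _ h (hypermap333_relators s1 s2).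
  apply/hypermap_relatorsP.
  split; [exact: model_a3 | exact: model_b3 | exact: model_ab3 |].
  exact: model_rel.
pose N := s1 ^ 2 + s1 * s2 + s2 ^ 2.
exists {perm 'Z_N * 'Z_N}, phi => i j k.
by rewrite !phiE !wvalue_gen; exact: model_ker.
Qed.

(** The kernel of the translation map does not depend on the target: an
    injective homomorphism sends a product to 1 only if it is 1 in G, and then
    its image in the finite model is 1 too. *)
Lemma embedding_ker (gT : finGroupType) (phi : {multiplicative G -> gT}) :
  injective phi ->
  forall i j k, transl (phi ga) (phi gb) i j * phi ga ^+ k = 1 ->
    3 %| k /\ in_lattice s1 s2 i j.
Proof.
move=> phi_inj i j k.
rewrite -multiplicative_transl -(multiplicativeX phi) -gmulfM.
rewrite -(multiplicative1 phi).
move/phi_inj => e; have [gT0 [phi0 ker0]] := exists_model.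
apply: ker0; rewrite -multiplicative_transl -(multiplicativeX phi0) -gmulfM e.
exact: multiplicative1.
Qed.

(** The model is faithful: an element of G in affine form that is trivial in the
    model is killed by the relators. *)
Lemma exists_embedding :
  exists (gT : finGroupType) (phi : {multiplicative G -> gT}), injective phi.
Proof.
have [gT [phi ker]] := exists_model; exists gT, phi.
have [a3 b3 ab3 rel] := hypermap_rel.
apply: (gmulf_inj (f := umagma_morphism_of phi)) => x.
rewrite -[umagma_morphism_of _ x]/(phi x).
have [i [j [k ->]]] := hypermap_affine x.
rewrite gmulfM multiplicative_transl multiplicativeX.
case/ker=> /dvdnP[m ->] [k' [l [-> ->]]].
by rewrite transl_in_lattice // mulnC expgnA a3 expg1n mulg1.
Qed.

Lemma embedding_core_free_index (gT : finGroupType)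
    (phi : {multiplicative G -> gT}) (Gam : {group gT}) n :
  injective phi -> (forall x, x \in Gam <-> exists g, phi g = x) ->
  ~ in_lattice s1 s2 1 (- 2%:Z)%R ->
  (exists H : {group gT},
     [/\ H \subset Gam, core_free Gam H & #|Gam : H| = n]) <->
  n = (s1 ^ 2 + s1 * s2 + s2 ^ 2)%N \/
  exists d, d %| gcdn s1 s2 /\ n = (3 * (s1 ^ 2 + s1 * s2 + s2 ^ 2)) %/ d.
Proof.
move=> phi_inj memGam not12.
set g := gcdn s1 s2.
have g_gt0 : 0 < g.
  by rewrite gcdn_gt0; move: N_gt1; case: (s1) (s2) => [|?] [|?].
have s1E : s1 = (g * (s1 %/ g))%N by rewrite mulnC divnK // dvdn_gcdl.
have s2E : s2 = (g * (s2 %/ g))%N by rewrite mulnC divnK // dvdn_gcdr.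
have [r [t bez]] : exists r t : int,
    (r * (Posz (s1 %/ g)) + t * (Posz (s2 %/ g)) = 1)%R.
  have [r [t e]] := Bezoutz s1%:Z s2%:Z; exists r, t.
  have g0 : (g%:Z != 0)%R by lia.
  apply: (mulfI g0); rewrite mulr1; apply: etrans e.
  by rewrite [in RHS]s1E [in RHS]s2E !PoszM; ring.
have [a3 b3 ab3 rel] := hypermap_rel.
have phi1 := multiplicative1 phi; have eX := multiplicativeX phi.
have eV := gmulfV (umagma_morphism_of phi).
apply: (core_free_index _ _ _ g_gt0 s1E s2E bez _ (embedding_ker phi_inj)) => //.
- by rewrite -eX a3.
- by rewrite -eX b3.
- by rewrite -gmulfM -eX ab3.
- by rewrite -eV -eV -!gmulfM -!eX -gmulfM rel.
move=> x; rewrite memGam; split=> [[y <-]|[i [j [k ->]]]].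
  have [i [j [k ->]]] := hypermap_affine y; exists i, j, k.
  by rewrite gmulfM multiplicative_transl eX.
by exists (transl ga gb i j * ga ^+ k); rewrite gmulfM multiplicative_transl eX.
Qed.

End Hypermap.

Theorem theorem6p2 (s1 s2 : nat)
    (s_neq0 : (s1, s2) <> (0, 0))
    (s_neq10 : (s1, s2) <> (1, 0))
    (s_neq01 : (s1, s2) <> (0, 1))
    (s_neq11 : (s1, s2) <> (1, 1))
    (n : nat) :
  faithful_transitive_degree (hypermap333_group s1 s2) n <->
    n = s1 ^ 2 + s1 * s2 + s2 ^ 2 \/
    exists d : nat, d %| gcdn s1 s2 /\ n = 3 * (s1 ^ 2 + s1 * s2 + s2 ^ 2) %/ d.
Proof.
have N_gt1 : 1 < s1 ^ 2 + s1 * s2 + s2 ^ 2.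
  by case: (s1) (s2) s_neq0 s_neq10 s_neq01 => [|[|m]] [|[|k]] //; lia.
have not12 := in_lattice_1_2 s_neq0 s_neq10 s_neq01 s_neq11.
split=> [/degree_core_free[gT [phi [phi_inj H]]]|].
  have [Gam memGam] := image_group phi.
  exact/(embedding_core_free_index N_gt1 _ phi_inj memGam not12)/H.
have [gT [phi phi_inj]] := exists_embedding N_gt1.
have [Gam memGam] := image_group phi.
case/(embedding_core_free_index N_gt1 _ phi_inj memGam not12) => H [HG cfH <-].
exact: (core_free_degree phi_inj memGam).
Qed.
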